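(* Let $\Lambda$ be a left and right Noetherian ring which is 2-Gorenstein. Then a non-zero proper left ideal $I$ of $\Lambda$ is reflexive (as a left $\Lambda$-module) if and only if $\Lambda/I$ has no non-zero pseudo-null submodule.
   Context: Let $0\to{}_\Lambda\Lambda\to I'_0\to I'_1\to\cdots$ be a minimal injective resolution of $\Lambda$ as a left module. $\Lambda$ is 2-Gorenstein if $I'_0$ is flat and $I'_1$ has flat dimension at most $1$. A finitely generated left module $M$ is reflexive if the canonical evaluation map $\sigma_M:M\to M^{**}$ is an isomorphism, where $(\ )^*=\mathrm{Hom}(\ ,\Lambda)$. It is pseudo-null if $\mathrm{Hom}_\Lambda(M,I'_0\oplus I'_1)=0$. *)

(* Defs.v *)
From HB Require Import structures.
From mathcomp Require Import all_boot all_algebra.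
From mathcomp Require Import boolp.
From mathcomp.multinomials Require Import freeg.

Set Implicit Arguments.
Unset Strict Implicit.
Unset Printing Implicit Defensive.

Import GRing.Theory.
Local Open Scope ring_scope.
Local Open Scope quotient_scope.

(* Left R-modules are [lmodType R], right R-modules are [lmodType R^c]. A     *)
(* submodule is a [submodClosed M]; a left ideal is a [submodClosed R^o].     *)

Section Submodule.
Variables (R : pzRingType) (M : lmodType R) (N : submodClosed M).

Record submod := Submod { submod_val : M; _ : submod_val \in N }.

HB.instance Definition _ := [isSub for submod_val].
HB.instance Definition _ := [Choice of submod by <:].

Lemma submod_submod_closed : submod_closed N.
Proof. exact: submodClosedP. Qed.

(* [submodClosed] does not record closure under opposite. *)
Definition zmodpred : {pred M} := fun x => x \in N.

Lemma zmodpred_closed : zmod_closed zmodpred.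
Proof. exact: GRing.submod_closedB submod_submod_closed. Qed.

HB.instance Definition _ := GRing.isZmodClosed.Build M zmodpred zmodpred_closed.

HB.instance Definition _ := GRing.SubChoice_isSubLmodule.Build R M
  (fun x => x \in N) submod submod_submod_closed.

Definition quotmod : Type := Quotient.quot zmodpred.

HB.instance Definition _ := GRing.Zmodule.on quotmod.
HB.instance Definition _ := Quotient.on quotmod.

Definition quotmod_pi (x : M) : quotmod := \pi x.

Lemma quotmodW (P : quotmod -> Prop) :
  (forall x, P (quotmod_pi x)) -> forall q, P q.
Proof. by move=> PM; elim/quotW. Qed.

Lemma quotmod_eq (x y : M) : (quotmod_pi x == quotmod_pi y) = (x - y \in N).
Proof. exact: esym (Quotient.idealrBE zmodpred x y). Qed.

Lemma quotmod_piD : {morph quotmod_pi : x y / x + y}.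
Proof. by move=> x y; exact: (raddfD (\pi_(Quotient.quot zmodpred))). Qed.

Definition quotmod_scale (a : R) (q : quotmod) : quotmod :=
  quotmod_pi (a *: repr q).

Lemma quotmod_piZ (a : R) (x : M) :
  quotmod_scale a (quotmod_pi x) = quotmod_pi (a *: x).
Proof.
apply/eqP; rewrite quotmod_eq -scalerBr rpredZ // -quotmod_eq.
by rewrite [X in X == _]reprK.
Qed.

Lemma quotmod_scaleA a b q :
  quotmod_scale a (quotmod_scale b q) = quotmod_scale (a * b) q.
Proof. by elim/quotmodW: q => x; rewrite !quotmod_piZ scalerA. Qed.

Lemma quotmod_scale1 : left_id 1 quotmod_scale.
Proof. by elim/quotmodW=> x; rewrite quotmod_piZ scale1r. Qed.

Lemma quotmod_scaleDr : right_distributive quotmod_scale +%R.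
Proof.
move=> a; elim/quotmodW=> x; elim/quotmodW=> y.
by rewrite -quotmod_piD !quotmod_piZ -quotmod_piD scalerDr.
Qed.

Lemma quotmod_scaleDl q : {morph quotmod_scale^~ q : a b / a + b}.
Proof.
by elim/quotmodW: q => x a b; rewrite !quotmod_piZ -quotmod_piD scalerDl.
Qed.

HB.instance Definition _ := GRing.Zmodule_isLmodule.Build R quotmod
  quotmod_scaleA quotmod_scale1 quotmod_scaleDr quotmod_scaleDl.

Lemma quotmod_pi_linear : linear quotmod_pi.
Proof. by move=> a x y; rewrite quotmod_piD -quotmod_piZ. Qed.
HB.instance Definition _ :=
  GRing.isLinear.Build R M quotmod *:%R quotmod_pi quotmod_pi_linear.

End Submodule.

Definition finitely_generated (R : pzRingType) (M : lmodType R) : Prop :=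
  exists n (e : 'I_n -> M), forall x, exists c : 'I_n -> R,
    x = \sum_i c i *: e i.

Definition noetherian (R : pzRingType) (M : lmodType R) : Prop :=
  forall N : nat -> submodClosed M,
    (forall n, {subset N n <= N n.+1}) ->
    exists n, forall m, (n <= m)%N -> N m =i N n.

Definition left_noetherian (R : pzRingType) : Prop := noetherian R^o.
Definition right_noetherian (R : pzRingType) : Prop := noetherian R^c^o.

Section Hom.
Variables (R : pzRingType) (U V : lmodType R).

Definition hom : Type := {linear U -> V}.
Identity Coercion linear_of_hom : hom >-> GRing.Linear.type.

HB.instance Definition _ := gen_eqMixin hom.
HB.instance Definition _ := gen_choiceMixin hom.

Lemma homP (f g : hom) : f =1 g -> f = g.
Proof.
case: f g => [f [[fD] [fZ]]] [g [[gD] [gZ]]] /= /funext fg.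
by subst g; rewrite (Prop_irrelevance gD fD) (Prop_irrelevance gZ fZ).
Qed.

Definition hom_zero : hom := \0 : {linear U -> V}.
Definition hom_add (f g : hom) : hom := f \+ g : {linear U -> V}.
Definition hom_opp (f : hom) : hom := \- f : {linear U -> V}.

Lemma hom_addA : associative hom_add.
Proof. by move=> f g h; apply: homP => x /=; rewrite addrA. Qed.
Lemma hom_addC : commutative hom_add.
Proof. by move=> f g; apply: homP => x /=; rewrite addrC. Qed.
Lemma hom_add0 : left_id hom_zero hom_add.
Proof. by move=> f; apply: homP => x /=; rewrite add0r. Qed.
Lemma hom_addN : left_inverse hom_zero hom_opp hom_add.
Proof. by move=> f; apply: homP => x /=; rewrite addNr. Qed.

HB.instance Definition _ :=
  GRing.isZmodule.Build hom hom_addA hom_addC hom_add0 hom_addN.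
End Hom.

(* For a left module M, M^* = Hom(M, R) is a right module:                    *)
(* (f . r) x = f x * r.                                                       *)
Section Dual.
Variables (R : pzRingType) (M : lmodType R).

Definition dual : Type := hom M R^o.
Identity Coercion hom_of_dual : dual >-> hom.
HB.instance Definition _ := GRing.Zmodule.on dual.

Section Scale.
Variables (r : R^c) (f : dual).
Definition dual_scale_fun (x : M) : R^o := (f x : R) * (r : R).
Lemma dual_scale_linear : linear dual_scale_fun.
Proof.
move=> a x y; rewrite /dual_scale_fun linearP mulrDl; congr (_ + _).
by rewrite -mulrA.
Qed.
HB.instance Definition _ :=
  GRing.isLinear.Build R M R^o *:%R dual_scale_fun dual_scale_linear.
Definition dual_scale : dual := dual_scale_fun : {linear M -> R^o}.
End Scale.

Lemma dual_scaleA a b f :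
  dual_scale a (dual_scale b f) = dual_scale (a * b) f.
Proof. by apply: homP => x; rewrite /= /dual_scale_fun /= /dual_scale_fun -mulrA. Qed.
Lemma dual_scale1 : left_id 1 dual_scale.
Proof. by move=> f; apply: homP => x; exact: (mulr1 (f x : R)). Qed.
Lemma dual_scaleDr : right_distributive dual_scale +%R.
Proof. by move=> a f g; apply: homP => x; exact: (mulrDl (f x : R) (g x)). Qed.
Lemma dual_scaleDl f : {morph dual_scale^~ f : a b / a + b}.
Proof. by move=> a b; apply: homP => x; exact: (mulrDr (f x : R)). Qed.

HB.instance Definition _ := GRing.Zmodule_isLmodule.Build R^c dual
  dual_scaleA dual_scale1 dual_scaleDr dual_scaleDl.
End Dual.

(* For a right module N, N^* = Hom(N, R) is a left module:                    *)
(* (r . g) f = r * g f.                                                       *)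
Section RDual.
Variables (R : pzRingType) (N : lmodType R^c).

Definition rdual : Type := hom N R^c^o.
Identity Coercion hom_of_rdual : rdual >-> hom.
HB.instance Definition _ := GRing.Zmodule.on rdual.

Section Scale.
Variables (r : R) (g : rdual).
Definition rdual_scale_fun (f : N) : R^c^o := r * (g f : R).
Lemma rdual_scale_linear : linear rdual_scale_fun.
Proof.
move=> a x y; rewrite /rdual_scale_fun linearP.
rewrite (mulrDr r); congr (_ + _).
by exact: (mulrA r).
Qed.
HB.instance Definition _ :=
  GRing.isLinear.Build R^c N R^c^o *:%R rdual_scale_fun rdual_scale_linear.
Definition rdual_scale : rdual := rdual_scale_fun : {linear N -> R^c^o}.
End Scale.

Lemma rdual_scaleA a b g :
  rdual_scale a (rdual_scale b g) = rdual_scale (a * b) g.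
Proof. by apply: homP => x; exact: (mulrA a b). Qed.
Lemma rdual_scale1 : left_id 1 rdual_scale.
Proof. by move=> g; apply: homP => x; exact: (mul1r (g x : R)). Qed.
Lemma rdual_scaleDr : right_distributive rdual_scale +%R.
Proof. by move=> a f g; apply: homP => x; exact: (mulrDr a). Qed.
Lemma rdual_scaleDl g : {morph rdual_scale^~ g : a b / a + b}.
Proof. by move=> a b; apply: homP => x; exact: (mulrDl a b). Qed.

HB.instance Definition _ := GRing.Zmodule_isLmodule.Build R rdual
  rdual_scaleA rdual_scale1 rdual_scaleDr rdual_scaleDl.
End RDual.

Section Evaluation.
Variables (R : pzRingType) (M : lmodType R).

Section Eval.
Variable x : M.
Definition eval_fun (f : dual M) : R^c^o := f x.
Lemma eval_linear : linear eval_fun.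
Proof. by []. Qed.
HB.instance Definition _ :=
  GRing.isLinear.Build R^c (dual M) R^c^o *:%R eval_fun eval_linear.
End Eval.

Definition sigma (x : M) : rdual (dual M) :=
  eval_fun x : {linear dual M -> R^c^o}.

Lemma sigma_linear : linear sigma.
Proof. by move=> a x y; apply: homP => f; exact: (linearP f). Qed.
HB.instance Definition _ :=
  GRing.isLinear.Build R M (rdual (dual M)) *:%R sigma sigma_linear.

Definition reflexive_module : Prop := finitely_generated M /\ bijective sigma.
End Evaluation.

Definition injective_module (R : pzRingType) (E : lmodType R) : Prop :=
  forall (A B : lmodType R) (i : {linear A -> B}) (f : {linear A -> E}),
    injective i -> exists g : {linear B -> E}, forall x, g (i x) = f x.

Definition essential_image (R : pzRingType) (A B : lmodType R)
    (f : {linear A -> B}) : Prop :=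
  forall N : submodClosed B, (exists2 y, y \in N & y != 0) ->
    exists2 x, f x \in N & f x != 0.

Definition exact_at (R : pzRingType) (A B C : lmodType R)
    (f : {linear A -> B}) (g : {linear B -> C}) : Prop :=
  forall y, g y = 0 <-> exists x, f x = y.

(* 0 -> M -> E_0 -> E_1 -> ... where each E_n is an injective envelope of the *)
(* image of the map into it.                                                  *)
Record min_inj_resolution (R : pzRingType) (M : lmodType R) := MinInjResolution {
  res_obj :> nat -> lmodType R;
  res_aug : {linear M -> res_obj 0};
  res_diff : forall n, {linear res_obj n -> res_obj n.+1};
  res_injective : forall n, injective_module (res_obj n);
  res_aug_inj : injective res_aug;
  res_exact0 : exact_at res_aug (res_diff 0);
  res_exactS : forall n, exact_at (res_diff n) (res_diff n.+1);
  res_aug_essential : essential_image res_aug;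
  res_diff_essential : forall n, essential_image (res_diff n)
}.

Definition pseudo_null (R : pzRingType) (E : min_inj_resolution R^o)
    (M : lmodType R) : Prop :=
  finitely_generated M /\ forall f : {linear M -> (E 0 * E 1)%type}, f =1 \0.

Section Tensor.
Variables (R : pzRingType) (A : lmodType R^c) (M : lmodType R).

Local Notation free := {freeg (A * M)%type / int}.
Local Notation gen a m := (<< (a, m) >> : free).

Inductive tensor_relator : free -> Prop :=
| TensorDl a b m : tensor_relator (gen (a + b) m - (gen a m + gen b m))
| TensorDr a m n : tensor_relator (gen a (m + n) - (gen a m + gen a n))
| TensorZ (r : R) a m : tensor_relator (gen ((r : R^c) *: a) m - gen a (r *: m)).

(* The subgroup generated by the relators. *)
Definition tensor_zero : {pred free} := fun z =>
  `[< forall H : zmodClosed free, (forall t, tensor_relator t -> t \in H) ->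
      z \in H >].

Lemma tensor_zero_closed : zmod_closed tensor_zero.
Proof.
split=> [|x y /asboolP xH /asboolP yH]; apply/asboolP => H HP.
  exact: rpred0.
by apply: rpredB; [exact: xH | exact: yH].
Qed.
HB.instance Definition _ :=
  GRing.isZmodClosed.Build free tensor_zero tensor_zero_closed.

Definition tensor : Type := Quotient.quot tensor_zero.
HB.instance Definition _ := GRing.Zmodule.on tensor.
HB.instance Definition _ := Quotient.on tensor.

Definition tensor_pi (z : free) : tensor := \pi z.

Lemma tensorW (P : tensor -> Prop) :
  (forall z, P (tensor_pi z)) -> forall t, P t.
Proof. by move=> PM; elim/quotW. Qed.

Lemma tensor_eq (y z : free) :
  (tensor_pi y == tensor_pi z) = (y - z \in tensor_zero).
Proof. exact: esym (Quotient.idealrBE tensor_zero y z). Qed.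

Lemma tensor_pi_is_zmod_morphism : zmod_morphism tensor_pi.
Proof. by move=> x y; exact: (raddfB (\pi_(Quotient.quot tensor_zero))). Qed.
HB.instance Definition _ :=
  GRing.isZmodMorphism.Build free tensor tensor_pi tensor_pi_is_zmod_morphism.

Definition tens (a : A) (m : M) : tensor := tensor_pi (gen a m).

Lemma tensor_relator0 z : tensor_relator z -> z \in tensor_zero.
Proof. by move=> zR; apply/asboolP => H; apply. Qed.

Lemma tensDl a b m : tens (a + b) m = tens a m + tens b m.
Proof.
apply/eqP; rewrite /tens -raddfD tensor_eq.
exact/tensor_relator0/TensorDl.
Qed.

Lemma tensDr a m n : tens a (m + n) = tens a m + tens a n.
Proof.
apply/eqP; rewrite /tens -raddfD tensor_eq.
exact/tensor_relator0/TensorDr.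
Qed.

Lemma tensZ (r : R) a m : tens ((r : R^c) *: a) m = tens a (r *: m).
Proof.
by apply/eqP; rewrite /tens tensor_eq; exact/tensor_relator0/TensorZ.
Qed.
End Tensor.
Arguments tensor_zero {R} A M.

Section TensorMap.
Variables (R : pzRingType) (A B : lmodType R^c) (M : lmodType R).
Variable f : {linear A -> B}.

Local Notation freeA := {freeg (A * M)%type / int}.
Local Notation freeB := {freeg (B * M)%type / int}.

Definition freeg_map : freeA -> freeB :=
  fglift (fun am => << (f am.1, am.2) >> : freeB).

Lemma freeg_map_is_zmod_morphism : zmod_morphism freeg_map.
Proof. exact: lift_is_additive. Qed.
HB.instance Definition _ :=
  GRing.isZmodMorphism.Build freeA freeB freeg_map freeg_map_is_zmod_morphism.

Lemma freeg_mapB : {morph freeg_map : y z / y - z}.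
Proof. exact: raddfB. Qed.

Lemma freeg_mapD : {morph freeg_map : y z / y + z}.
Proof. exact: raddfD. Qed.

Lemma freeg_mapU a m : freeg_map << (a, m) >> = << (f a, m) >>.
Proof. by rewrite /freeg_map liftU scale1r. Qed.

Definition tensor_map (t : tensor A M) : tensor B M :=
  tensor_pi (freeg_map (repr t)).

Lemma freeg_map_zero (z : freeA) :
  z \in tensor_zero A M -> freeg_map z \in tensor_zero B M.
Proof.
move=> /asboolP zA.
pose P : {pred freeA} := fun z => freeg_map z \in tensor_zero B M.
have Pcl : zmod_closed P.
  split=> [|x y xP yP]; first by rewrite unfold_in raddf0 rpred0.
  by rewrite unfold_in raddfB rpredB.
pose PC := GRing.isZmodClosed.Build freeA P Pcl.
pose H : zmodClosed freeA := HB.pack P PC.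
apply: (zA H) => t tR; rewrite -[_ \in H]/(freeg_map t \in tensor_zero B M).
case: tR => [a b m|a m n|r a m]; rewrite freeg_mapB ?freeg_mapD !freeg_mapU.
- by rewrite (raddfD f); apply/tensor_relator0/TensorDl.
- by apply/tensor_relator0/TensorDr.
- by rewrite linearZ; apply/tensor_relator0/TensorZ.
Qed.

Lemma tensor_map_pi (z : freeA) : tensor_map (tensor_pi z) = tensor_pi (freeg_map z).
Proof.
apply/eqP; rewrite tensor_eq -raddfB freeg_map_zero // -tensor_eq.
by rewrite [X in X == _]reprK.
Qed.

Lemma tensor_map_is_zmod_morphism : zmod_morphism tensor_map.
Proof.
elim/tensorW=> x; elim/tensorW=> y.
by rewrite -raddfB !tensor_map_pi !raddfB.
Qed.
HB.instance Definition _ := GRing.isZmodMorphism.Build (tensor A M) (tensor B M)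
  tensor_map tensor_map_is_zmod_morphism.

Lemma tensor_map_tens a m : tensor_map (tens a m) = tens (f a) m.
Proof. by rewrite tensor_map_pi freeg_mapU. Qed.
End TensorMap.

Definition flat (R : pzRingType) (M : lmodType R) : Prop :=
  forall (A B : lmodType R^c) (f : {linear A -> B}),
    injective f -> injective (tensor_map (M := M) f).

(* There is an exact sequence 0 -> F_n -> ... -> F_0 -> M -> 0 with all F_i   *)
(* flat.                                                                      *)
Fixpoint flat_dim_le (R : pzRingType) (n : nat) (M : lmodType R) : Prop :=
  if n is n'.+1 then
    exists (K F : lmodType R) (i : {linear K -> F}) (p : {linear F -> M}),
      [/\ flat_dim_le n' K, flat F, injective i, exact_at i p
        & forall x, exists y, p y = x]
  else flat M.

Definition two_gorenstein (R : pzRingType) (E : min_inj_resolution R^o) : Prop :=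
  flat (E 0) /\ flat_dim_le 1 (E 1).

(* Main.v *)
(* Write R for Lambda. The flat dimension of E_0 and E_1 enters through one     *)
(* fact: for a finitely presented left module M and a module N of flat          *)
(* dimension at most 1, the map M^* (x) N -> Hom(M, N) is injective. Since M^*  *)
(* is finitely generated, this implies that a map M^** -> E_i vanishing on      *)
(* sigma(M) is zero: the cokernel of sigma is pseudo-null.                      *)
(*                                                                              *)
(* If R/I has no pseudo-null submodule, apply this to M = I. The image of I^**  *)
(* in R under phi |-> phi(incl) contains I with pseudo-null quotient, hence is  *)
(* I; and phi |-> phi(incl) is injective, because its kernel meets I trivially  *)
(* and maps to E_0 extend along injections. Conversely, let J/I be pseudo-null; *)
(* as R embeds in E_0 and E_0/R in E_1, each map I -> R extends uniquely to J,  *)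
(* so x in J gives the element g |-> (extension of g)(x) of I^**. If I is       *)
(* reflexive this is evaluation at some y in I, and g = incl gives x = y.       *)

Require Import Defs.
From HB Require Import structures.
From mathcomp Require Import all_boot all_algebra boolp.
From mathcomp.multinomials Require Import freeg.
Set Implicit Arguments.
Unset Strict Implicit.
Unset Printing Implicit Defensive.

Import GRing.Theory.
Local Open Scope ring_scope.
Local Open Scope quotient_scope.

(** Why M^* (x) N -> Hom(M, N) is injective: a presentation R^q -> R^n -> M -> 0 dualizes to an
    exact sequence 0 -> M^* -> R^n -> R^q of right modules ([dual_coord_inj], [dual_coord_exact]).
    If N is flat, M^* (x) N embeds in N^n, with the values at the generators of M as coordinates
    ([dual_tensor_flat]). If 0 -> K -> F -> N -> 0 is exact with K and F flat, a diagram chase using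
    [tensor_exact] for K reduces N to the flat case ([dual_tensor_fd1]).

    The left Noetherian condition presents the ideal I; the right one makes I^* finitely generated.
    [bidual_hom_eq0] then shows that maps from I^** to E_0 or E_1 killing sigma(I) vanish, and
    [reflexive_of_torsionfree_quotient] draws the conclusion. The converse is
    [torsionfree_quotient_of_reflexive]. *)

(** * Submodules and factorization of linear maps *)

Definition linear_of (R : pzRingType) (U V : lmodType R) (f : U -> V)
    (fL : linear f) : {linear U -> V} :=
  HB.pack f (GRing.isLinear.Build R U V *:%R f fL).

Lemma submod_of_prop (R : pzRingType) (M : lmodType R) (P : M -> Prop) :
  P 0 -> (forall a x y, P x -> P y -> P (a *: x + y)) ->
  exists N : submodClosed M, forall x, x \in N <-> P x.
Proof.
move=> P0 PL.
pose S : {pred M} := fun x => `[< P x >].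
have Scl : submod_closed S.
  split; first exact/asboolP.
  by move=> a x y /asboolP Px /asboolP Py; apply/asboolP/PL.
pose SC := GRing.isSubmodClosed.Build R M S Scl.
by exists (HB.pack S SC : submodClosed M) => x; split=> /asboolP.
Qed.

Lemma quotmod_pi0 (R : pzRingType) (M : lmodType R) (N : submodClosed M) x :
  quotmod_pi N x = 0 <-> x \in N.
Proof. by rewrite -{2}[x]subr0 -quotmod_eq linear0; split=> /eqP. Qed.

(** Take f o s for a section s of p: f is constant on the fibres of p, so the choice of s does not
    matter, and linearity follows. *)
Lemma factor_surj (R : pzRingType) (A M V : lmodType R)
    (p : {linear A -> M}) (f : {linear A -> V}) :
  (forall x, exists a, p a = x) -> (forall a, p a = 0 -> f a = 0) ->
  exists g : {linear M -> V}, forall a, g (p a) = f a.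
Proof.
move=> /choice[s sK] kerf.
have fs a b : p a = p b -> f a = f b.
  by move=> /eqP; rewrite -subr_eq0 -linearB => /eqP/kerf/eqP; rewrite linearB subr_eq0 => /eqP.
have gL : linear (f \o s).
  by move=> a x y /=; rewrite -linearP; apply: fs; rewrite linearP !sK.
by exists (linear_of gL) => a; apply: fs; rewrite sK.
Qed.

(** * Tensor products: universal property, generation by pure tensors, exactness *)

Section TensorLift.
Variables (R : pzRingType) (A : lmodType R^c) (M : lmodType R) (Z : zmodType).
Variable b : A -> M -> Z.
Hypothesis bDl : forall a a' m, b (a + a') m = b a m + b a' m.
Hypothesis bDr : forall a m m', b a (m + m') = b a m + b a m'.
Hypothesis bZ : forall (r : R) a m, b ((r : R^c) *: a) m = b a (r *: m).

Lemma tensor_lift : exists h : {additive tensor A M -> Z},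
  forall a m, h (tens a m) = b a m.
Proof.
pose l : {freeg (A * M)%type / int} -> zmodule Z :=
  fglift (fun am => b am.1 am.2 : zmodule Z).
have lB : {morph l : x y / x - y} := lift_is_additive _.
pose lC := GRing.isZmodMorphism.Build _ _ l lB.
pose la : {additive _ -> _} := HB.pack l lC.
have lU a m : l << (a, m) >> = b a m by rewrite /l liftU scale1r.
have l0 z : z \in tensor_zero A M -> l z = 0.
  move=> /asboolP zA.
  pose P : {pred {freeg (A * M)%type / int}} := fun z => l z == 0.
  have Pcl : zmod_closed P.
    split=> [|x y /eqP xP /eqP yP]; rewrite unfold_in.
      by rewrite -[l]/(la : _ -> _) raddf0.
    by rewrite lB xP yP subr0.
  pose PC := GRing.isZmodClosed.Build _ P Pcl.
  pose H : zmodClosed _ := HB.pack P PC.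
  apply/eqP; apply: (zA H) => t tR; rewrite -[_ \in H]/(l t == 0).
  have lD x y : l (x + y) = l x + l y by rewrite -[l]/(la : _ -> _) raddfD.
  by case: tR => *; rewrite lB ?lD !lU ?bDl ?bDr ?bZ subrr.
have lpi z : l (repr (tensor_pi z)) = l z.
  apply/eqP; rewrite -subr_eq0 -lB; apply/eqP/l0.
  by rewrite -tensor_eq; apply/eqP; exact: reprK.
pose h (t : tensor A M) : Z := l (repr t).
have hB : {morph h : x y / x - y}.
  by elim/tensorW=> x; elim/tensorW=> y; rewrite /h -raddfB !lpi lB.
pose hC := GRing.isZmodMorphism.Build (tensor A M) Z h hB.
by exists (HB.pack h hC : {additive tensor A M -> Z}) => a m; rewrite -lU -lpi.
Qed.
End TensorLift.

Lemma tensor_ind (R : pzRingType) (A : lmodType R^c) (M : lmodType R)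
    (P : tensor A M -> Prop) :
  (forall a m, P (tens a m)) -> (forall x y, P x -> P y -> P (x - y)) ->
  forall t, P t.
Proof.
move=> Ptens PB; have P0 : P 0 by rewrite -(subrr (tens 0 0)); apply: PB.
have PN x : P x -> P (- x) by move=> Px; rewrite -[- x]sub0r; apply: PB.
have PD x y : P x -> P y -> P (x + y).
  by move=> Px /PN Py; rewrite -[y]opprK; apply: PB.
have PM n x : P x -> P (x *+ n).
  by move=> Px; elim: n => [|n IHn]; rewrite ?mulr0n // mulrS; apply: PD.
elim/tensorW; elim/freeg_ind_dom0 => [|k [a m] z _ _ Pz]; first by rewrite raddf0.
rewrite raddfD; apply: PD => //.
have -> : << k *g (a, m) >> = << (a, m) >> *~ k :> {freeg (A * M)%type / int}.
  by apply/eqP/freeg_eqP => x; rewrite raddfMz /= !coeffU mul1r -mulrzr intz mulrC.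
rewrite raddfMz; case: k => n; first exact/PM/Ptens.
exact/PN/PM/Ptens.
Qed.

(** With K = ker g, the map P/K -> X is injective, so by flatness t already dies in (P/K) (x) M. By
    right exactness (P/K) (x) M maps to the cokernel [Q] of f (x) M compatibly with [pi], so t dies
    in [Q]. *)
Lemma tensor_exact (R : pzRingType) (S P X : lmodType R^c) (M : lmodType R)
    (f : {linear S -> P}) (g : {linear P -> X}) (t : tensor P M) :
  flat M -> exact_at f g -> tensor_map g t = 0 ->
  exists u : tensor S M, tensor_map f u = t.
Proof.
move=> flatM fg gt0.
have [||K KE] := @submod_of_prop _ P (fun x => g x = 0); first exact: linear0.
  by move=> a x y gx gy; rewrite linearP gx gy scaler0 addr0.
have [|| g' g'E] := @factor_surj _ _ _ _ (quotmod_pi K) g.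
  by elim/quotmodW=> x; exists x.
  by move=> a /quotmod_pi0/KE.
have g'I : injective g'.
  elim/quotmodW=> x; elim/quotmodW=> y; rewrite !g'E => xy.
  by apply/eqP; rewrite quotmod_eq; apply/KE; rewrite linearB xy subrr.
pose D : {pred tensor P M} := fun t => `[< exists u, tensor_map f u = t >].
have Dcl : zmod_closed D.
  split; first by apply/asboolP; exists 0; rewrite raddf0.
  move=> _ _ /asboolP[x <-] /asboolP[y <-].
  by apply/asboolP; exists (x - y); rewrite raddfB.
pose DC : zmodClosed (tensor P M) :=
  HB.pack D (GRing.isZmodClosed.Build _ D Dcl).
pose Q : zmodType := Quotient.quot DC.
pose pi : {additive _ -> Q} := \pi_(Quotient.quot DC).
have pi0 x : pi x = 0 <-> exists u, tensor_map f u = x.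
  rewrite -(raddf0 pi); split.
    move=> /eqP; rewrite -[_ == _]Quotient.idealrBE subr0.
    by move=> /asboolP.
  move=> xD; apply/eqP; rewrite -[_ == _]Quotient.idealrBE subr0; exact/asboolP.
have piP x y m : quotmod_pi K x = quotmod_pi K y ->
    pi (tens x m) = pi (tens y m).
  move=> /eqP; rewrite quotmod_eq => /KE/fg[s fs].
  apply/eqP; rewrite -subr_eq0 -raddfB; apply/eqP/pi0.
  exists (tens s m); rewrite tensor_map_tens fs.
  by apply/eqP; rewrite eq_sym subr_eq -tensDl subrK.
have reprE x : quotmod_pi K (repr x) = x by exact: (reprK x).
(* Representatives may be used: by [piP], changing x by an element of K = im f does not change the
   class of x (x) m in [Q]. *)
have [||| h hE] := @tensor_lift _ (quotmod K) M Q
    (fun q m => pi (tens (repr q) m)).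
- move=> q q' m; rewrite -raddfD -tensDl; apply: piP.
  by rewrite linearD /= !reprE.
- by move=> q m m'; rewrite tensDr raddfD.
- by move=> r q m; rewrite -tensZ; apply: piP; rewrite linearZ /= !reprE.
have hpi : h (tensor_map (quotmod_pi K) t) = pi t.
  elim/tensor_ind: t {gt0} => [a m|x y xE yE]; last by rewrite !raddfB xE yE.
  by rewrite tensor_map_tens hE; apply: piP; rewrite reprE.
apply/pi0; rewrite -hpi -(raddf0 h); congr (h _).
apply: (flatM _ _ g' g'I); rewrite raddf0 -gt0.
elim/tensor_ind: t {gt0 hpi} => [a m|x y xE yE]; last by rewrite !raddfB /= xE yE.
by rewrite !tensor_map_tens g'E.
Qed.

Section TensorFacts.
Variables (R : pzRingType) (A : lmodType R^c) (M N : lmodType R).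

Lemma tens_suml (I : finType) (a : I -> A) (m : M) :
  tens (\sum_i a i) m = \sum_i tens (a i) m.
Proof.
have tens0 : tens (0 : A) m = 0.
  by apply: (@addrI _ (tens 0 m)); rewrite -tensDl !addr0.
by apply: (big_morph (fun a : A => tens a m)) => // x y; rewrite tensDl.
Qed.

Lemma tensBr (a : A) (x y : M) : tens a (x - y) = tens a x - tens a y.
Proof. by apply/eqP; rewrite eq_sym subr_eq -tensDr subrK. Qed.

Lemma tens0r (a : A) : tens a (0 : M) = 0.
Proof. by rewrite -(subrr 0) tensBr subrr. Qed.

Lemma tensor_mapr_subproof (p : {linear M -> N}) :
  exists h : {additive tensor A M -> tensor A N},
  forall a m, h (tens a m) = tens a (p m).
Proof.
apply: tensor_lift => [a a' m|a m m'|r a m]; first exact: tensDl.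
  by rewrite raddfD tensDr.
by rewrite linearZ tensZ.
Qed.

Definition tensor_mapr (p : {linear M -> N}) := sval (cid (tensor_mapr_subproof p)).

Lemma tensor_mapr_tens (p : {linear M -> N}) a m :
  tensor_mapr p (tens a m) = tens a (p m).
Proof. exact: (svalP (cid (tensor_mapr_subproof p))). Qed.

Lemma tens_sumr (I : finType) (a : A) (m : I -> M) :
  tens a (\sum_i m i) = \sum_i tens a (m i).
Proof.
apply: (big_morph (fun m : M => tens a m)); last exact: tens0r.
by move=> x y; rewrite tensDr.
Qed.
End TensorFacts.

Lemma tensor_map_mapr (R : pzRingType) (A B : lmodType R^c) (M N : lmodType R)
    (f : {linear A -> B}) (p : {linear M -> N}) (t : tensor A M) :
  tensor_map f (tensor_mapr A p t) = tensor_mapr B p (tensor_map f t).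
Proof.
elim/tensor_ind: t => [a m|x y xE yE]; last by rewrite !raddfB /= xE yE.
by rewrite tensor_mapr_tens !tensor_map_tens tensor_mapr_tens.
Qed.

(** * The canonical map M^* (x) N -> Hom(M, N) *)

Section DualTensor.
Variables (R : pzRingType) (M : lmodType R).

Section Eval.
Variables (N : lmodType R) (y : M).

Lemma dual_eval_subproof :
  exists h : {additive tensor (dual M) N -> N},
  forall g x, h (tens g x) = (g y : R) *: x.
Proof.
apply: tensor_lift => [g g' x|g x x'|r g x]; first exact: scalerDl.
  exact: scalerDr.
by rewrite scalerA.
Qed.

(** The canonical map g (x) x |-> (y |-> g(y) x), kept as a family of evaluations at points y; its
    injectivity says that t = 0 as soon as every [dual_eval N y t] vanishes. *)
Definition dual_eval := sval (cid dual_eval_subproof).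

Lemma dual_eval_tens g x : dual_eval (tens g x) = (g y : R) *: x.
Proof. exact: (svalP (cid dual_eval_subproof)). Qed.
End Eval.

Lemma dual_eval_mapr (N N' : lmodType R) (p : {linear N -> N'}) y t :
  dual_eval N' y (tensor_mapr _ p t) = p (dual_eval N y t).
Proof.
elim/tensor_ind: t => [g x|x x' xE x'E]; last by rewrite !raddfB xE x'E.
by rewrite tensor_mapr_tens !dual_eval_tens linearZ.
Qed.

Variables (n : nat) (p : {linear 'rV[R]_n -> M}).
Hypothesis p_surj : forall x, exists v, p v = x.

(** The dual of p, with the dual of R^n written as rows over the opposite ring. *)
Definition dual_coord_fun (g : dual M) : 'rV[R^c]_n := \row_k g (p 'e_k).
Lemma dual_coord_linear : linear dual_coord_fun.
Proof. by move=> r g h; apply/rowP => k; rewrite !mxE. Qed.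
Definition dual_coord := linear_of dual_coord_linear.

Lemma dual_coordE (g : dual M) (v : 'rV_n) :
  g (p v) = \sum_k (v 0 k : R) * (dual_coord g 0 k : R).
Proof.
rewrite [v in LHS]row_sum_delta !linear_sum; apply: eq_bigr => k _.
by rewrite !linearZ mxE.
Qed.

Lemma dual_coord_inj : injective dual_coord.
Proof.
move=> g h gh; apply: homP => x; have [v <-] := p_surj x.
by rewrite !dual_coordE gh.
Qed.

Lemma dual_eval_coord (N : lmodType R) (v : 'rV_n) (t : tensor (dual M) N) :
  dual_eval N (p v) t = \sum_k v 0 k *: dual_eval N (p 'e_k) t.
Proof.
elim/tensor_ind: t => [g x|x x' xE x'E].
  rewrite dual_eval_tens dual_coordE scaler_suml; apply: eq_bigr => k _.
  by rewrite dual_eval_tens scalerA mxE.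
rewrite raddfB xE x'E -sumrB; apply: eq_bigr => k _.
by rewrite raddfB scalerBr.
Qed.

Lemma dual_eval0 (N : lmodType R) (t : tensor (dual M) N) : dual_eval N 0 t = 0.
Proof.
elim/tensor_ind: t => [g x|x x' xE x'E]; last by rewrite raddfB xE x'E subr0.
by rewrite dual_eval_tens linear0 scale0r.
Qed.

Lemma tensor_map_dual_coord (N : lmodType R) (t : tensor (dual M) N) :
  tensor_map dual_coord t = \sum_k tens ('e_k : 'rV[R^c]_n) (dual_eval N (p 'e_k) t).
Proof.
elim/tensor_ind: t => [g x|x x' xE x'E]; last first.
  rewrite raddfB /= xE x'E -sumrB; apply: eq_bigr => k _.
  by rewrite raddfB tensBr.
rewrite tensor_map_tens [X in tens X]row_sum_delta tens_suml.
by apply: eq_bigr => k _; rewrite dual_eval_tens tensZ mxE.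
Qed.

(** Flatness of F turns the embedding M^* -> R^n into an embedding of M^* (x) F in F^n, and the
    coordinates of the image of t are its values at the generators [p 'e_k]. *)
Lemma dual_tensor_flat (F : lmodType R) (t : tensor (dual M) F) :
  flat F -> (forall y, dual_eval F y t = 0) -> t = 0.
Proof.
move=> flatF t0; apply: (flatF _ _ _ dual_coord_inj).
rewrite raddf0 tensor_map_dual_coord big1 // => k _.
by rewrite t0 tens0r.
Qed.

Variables (q : nat) (c : {linear 'rV[R]_q -> 'rV[R]_n}).
Hypothesis cp : exact_at c p.

(** The dual of c: the matrix of c acting on columns of coefficients, here written as rows. *)
Definition corel_fun (v : 'rV[R^c]_n) : 'rV[R^c]_q :=
  \row_l (\sum_k (c 'e_l 0 k : R) * (v 0 k : R) : R).
Lemma corel_linear : linear corel_fun.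
Proof.
move=> r v w; apply/rowP => l; rewrite !mxE.
rewrite -[r * _]/((\sum_k (c 'e_l 0 k : R) * (v 0 k : R)) * (r : R)).
rewrite mulr_suml -big_split; apply: eq_bigr => k _.
by rewrite !mxE mulrDr -mulrA.
Qed.
Definition corel := linear_of corel_linear.

Lemma corelE (w : 'rV[R]_q) (v : 'rV[R^c]_n) :
  \sum_k (c w 0 k : R) * (v 0 k : R) = \sum_l (w 0 l : R) * (corel v 0 l : R).
Proof.
under [RHS]eq_bigr do rewrite mxE mulr_sumr.
rewrite exchange_big; apply: eq_bigr => k _.
rewrite [w in LHS]row_sum_delta linear_sum summxE mulr_suml.
by apply: eq_bigr => l _; rewrite linearZ mxE mulrA.
Qed.

(** Left exactness of Hom(-, R): a functional on R^n that kills the relations im c factors through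
    M. *)
Lemma dual_coord_exact : exact_at dual_coord corel.
Proof.
move=> v; split=> [v0|[g <-]]; last first.
  apply/rowP => l; rewrite [LHS]mxE [RHS]mxE -dual_coordE.
  by rewrite (_ : p (c 'e_l) = 0) ?linear0 //; apply/cp; exists 'e_l.
have fL : linear (fun w : 'rV[R]_n => \sum_k (w 0 k : R) * (v 0 k : R) : R^o).
  move=> a w w'; rewrite scaler_sumr -big_split; apply: eq_bigr => k _.
  by rewrite !mxE mulrDl -mulrA.
have [w /cp[u <-]|g gE] := @factor_surj _ _ _ _ p (linear_of fL) p_surj.
  rewrite /= corelE big1 // => l _.
  by rewrite v0 mxE mulr0.
exists g; apply/rowP => k; rewrite mxE gE /= (bigD1 k) //= big1 => [|j jk].
  by rewrite mxE !eqxx mul1r addr0.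
by rewrite mxE (negPf jk) andbF mul0r.
Qed.

(** Chase along 0 -> K -> F -> N -> 0: a lift u of t to M^* (x) F takes its values in K, and comes
    from some w in M^* (x) K, which maps to 0 in M^* (x) N. *)
Lemma dual_tensor_fd1 (N : lmodType R) (t : tensor (dual M) N) :
  flat_dim_le 1 N -> (forall y, dual_eval N y t = 0) -> t = 0.
Proof.
move=> [K [F [i [r [flatK flatF iI ir rS]]]]] t0.
have [u ut] : exists u, tensor_mapr _ r u = t.
  elim/tensor_ind: t {t0} => [g x|x x' [u <-] [u' <-]].
    by have [y <-] := rS x; exists (tens g y); rewrite tensor_mapr_tens.
  by exists (u - u'); rewrite raddfB.
(* The values of t vanish, so those of u at the generators lie in K; they form an element of K^n,
   that is, of R^n (x) K. *)
have /choice[v vE] k : exists v, i v = dual_eval F (p 'e_k) u.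
  by apply/ir; rewrite -dual_eval_mapr ut.
(* [corel] sends this element to the values of u at the points [p (c 'e_l)], which are 0; flatness
   of K then lifts it to M^* (x) K. *)
have [|w wE] := tensor_exact (t := \sum_k tens ('e_k : 'rV[R^c]_n) (v k))
  flatK dual_coord_exact.
  rewrite raddf_sum /=.
  under eq_bigr => k _.
    rewrite tensor_map_tens [X in tens X]row_sum_delta tens_suml.
    under eq_bigr do rewrite tensZ.
    over.
  rewrite exchange_big big1 // => l _; rewrite -tens_sumr /=.
  rewrite (_ : \sum_k _ = 0) ?tens0r //; apply: iI; rewrite raddf0 linear_sum /=.
  transitivity (dual_eval F (p (c 'e_l)) u).
    rewrite dual_eval_coord; apply: eq_bigr => k _.
    rewrite linearZ /= vE mxE (bigD1 k) //= big1 => [|j jk].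
      by rewrite mxE !eqxx mulr1 addr0.
    by rewrite mxE (negPf jk) andbF mulr0.
  have -> : p (c 'e_l) = 0 by apply/cp; exists 'e_l.
  exact: dual_eval0.
(* u and the image of w have the same coordinates in F^n, hence agree because F is flat. *)
have -> : t = tensor_mapr _ r (tensor_mapr _ i w).
  rewrite -ut; congr (tensor_mapr _ r _).
  apply: (flatF _ _ _ dual_coord_inj); rewrite tensor_map_dual_coord.
  rewrite tensor_map_mapr wE raddf_sum; apply: eq_bigr => k _.
  by rewrite /= tensor_mapr_tens vE.
elim/tensor_ind: w {wE} => [g x|x x' xE x'E]; last by rewrite !raddfB xE x'E subr0.
by rewrite !tensor_mapr_tens (_ : r (i x) = 0) ?tens0r //; apply/ir; exists x.
Qed.
End DualTensor.

(** * Noetherian modules and finite generation *)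

Definition submod_incl (R : pzRingType) (M : lmodType R) (N : submodClosed M) :
  {linear submod N -> M} := \val.

Section Span.
Variables (R : pzRingType) (M : lmodType R).

Definition span_of (s : seq M) (x : M) : Prop :=
  forall N : submodClosed M, {subset s <= N} -> x \in N.

Definition fg_submod (N : submodClosed M) : Prop :=
  exists2 s : seq M, {subset s <= N} & forall x, x \in N -> span_of s x.

Lemma span_of_coef s x :
  span_of s x -> exists c : 'I_(size s) -> R, x = \sum_i c i *: s`_i.
Proof.
move=> sx.
have [||N NE] := @submod_of_prop _ M
    (fun x => exists c : 'I_(size s) -> R, x = \sum_i c i *: s`_i).
- by exists (fun=> 0); rewrite big1 // => i _; rewrite scale0r.
- move=> a _ _ [c ->] [d ->]; exists (fun i => a * c i + d i).
  by rewrite scaler_sumr -big_split; apply: eq_bigr => i _; rewrite scalerDl scalerA.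
apply/NE/sx => y ys; apply/NE.
have lt_i : (index y s < size s)%N by rewrite index_mem.
exists (fun i => (i == Ordinal lt_i)%:R).
rewrite (bigD1 (Ordinal lt_i)) //= eqxx scale1r nth_index // big1 ?addr0 //.
by move=> i /negPf ->; rewrite scale0r.
Qed.

Lemma fg_submodP (N : submodClosed M) :
  fg_submod N -> exists n (e : 'I_n -> M), (forall i, e i \in N) /\
    forall x, x \in N -> exists c : 'I_n -> R, x = \sum_i c i *: e i.
Proof.
move=> [s sN Ns]; exists (size s), (fun i => s`_i); split.
  by move=> i; apply/sN/mem_nth.
by move=> x /Ns/span_of_coef.
Qed.

Definition noeth : Prop := forall N : submodClosed M, fg_submod N.

(** If N is not finitely generated, choosing repeatedly an element of N outside the span of the
    earlier ones makes these spans a strictly increasing chain. *)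
Lemma noetherian_fg : noetherian M -> noeth.
Proof.
move=> noethM N; apply: contrapT => notfg.
have /choice[next nextP] (s : seq M) : exists x,
    {subset s <= N} -> x \in N /\ ~ span_of s x.
  (* 0 is a default for lists that are not contained in N. *)
  have [sN|] := pselect {subset s <= N}; last by exists 0.
  apply: contrapT => noX; apply: notfg; exists s => // x xN.
  by apply: contrapT => nsx; apply: noX; exists x.
pose s n := iter n (fun s => next s :: s) [::].
have sN n : {subset s n <= N}.
  elim: n => [|n IHn] x //; rewrite /= inE => /predU1P[->|/IHn //].
  by have [] := nextP _ IHn.
have /choice[C CE] n : exists S : submodClosed M, forall x, x \in S <-> span_of (s n) x.
  apply: submod_of_prop => [S _|a x y sx sy S sS]; first exact: rpred0.
  by rewrite rpredD ?rpredZ //; [exact: sx | exact: sy].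
have [n x /CE sx|n nP] := noethM C.
  by apply/CE => S sS; apply: sx => y ys; apply: sS; rewrite /= inE ys orbT.
have [_] := nextP _ (sN n); apply; apply/CE; rewrite -(nP n.+1) //.
by apply/CE => S; apply; rewrite /= mem_head.
Qed.
End Span.

Section NoethExt.
Variables (R : pzRingType) (B M A : lmodType R).
Variables (g : {linear B -> M}) (f : {linear M -> A}).

(** N is generated by lifts [t] of generators of f(N) together with the images of generators of the
    preimage of N under g: any x in N agrees under f with some y in the span of [t], and x - y lies
    in ker f, hence in the image of g. *)
Lemma noeth_ext : (forall x, f x = 0 -> exists b, g b = x) ->
  noeth B -> noeth A -> noeth M.
Proof.
move=> kerf noethB noethA N.
have [||N1 N1E] := @submod_of_prop _ A (fun a => exists2 x, x \in N & f x = a).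
- by exists 0; rewrite ?rpred0 ?linear0.
- move=> a _ _ [x xN <-] [y yN <-]; exists (a *: x + y); last exact: linearP.
  by rewrite rpredD ?rpredZ.
have [||N2 N2E] := @submod_of_prop _ B (fun b => g b \in N).
- by rewrite linear0 rpred0.
- by move=> a x y xN yN; rewrite linearP rpredD ?rpredZ.
have [s2 s2N N2s] := noethB N2; have [s1 s1N N1s] := noethA N1.
have [t tN ft] : exists2 t : seq M, {subset t <= N} & map f t = s1.
  elim: s1 s1N {N1s} => [|a s IHs] sN1; first by exists [::].
  have /N1E[x xN fx] : a \in N1 by rewrite sN1 ?mem_head.
  have [|t tN ft] := IHs; first by move=> y ys; rewrite sN1 ?inE ?ys ?orbT.
  exists (x :: t); last by rewrite /= fx ft.
  by move=> y; rewrite inE => /predU1P[->|/tN].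
exists (t ++ map g s2) => [x|x xN S sS].
  by rewrite mem_cat => /orP[/tN //|/mapP[b /s2N/N2E gb ->]].
(* S is an arbitrary submodule containing the proposed generators. S1 = f(N and S) contains the
   generators of f(N), hence f x, which yields y in both N and S with f y = f x. *)
have [||S1 S1E] := @submod_of_prop _ A (fun a => exists2 x, x \in N & x \in S /\ f x = a).
- by exists 0; rewrite ?rpred0 ?linear0.
- move=> a _ _ [y yN [yS <-]] [z zN [zS <-]]; exists (a *: y + z).
    by rewrite rpredD ?rpredZ.
  by rewrite rpredD ?rpredZ // linearP.
have [||S2 S2E] := @submod_of_prop _ B (fun b => g b \in S).
- by rewrite linear0 rpred0.
- by move=> a y z yS zS; rewrite linearP rpredD ?rpredZ.
have /N1s/(_ S1) : f x \in N1 by apply/N1E; exists x.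
case/(_ _)/S1E => [a|y yN [yS fxy]].
  rewrite -ft => /mapP[y yt ->]; apply/S1E; exists y; first exact: tN.
  by split=> //; apply: sS; rewrite mem_cat yt.
have [b gb] : exists b, g b = x - y.
  by apply: kerf; rewrite linearB fxy subrr.
rewrite -(subrK y x) rpredD // -gb; apply/S2E.
apply: (N2s b).
  by apply/N2E; rewrite gb -scaleN1r rpredD ?rpredZ.
by move=> c cs; apply/S2E/sS; rewrite mem_cat map_f ?orbT.
Qed.
End NoethExt.

(** ['rV[R]_0] serves as the zero module when [noeth_ext] is applied to an injection or a
    surjection. *)
Lemma noeth_row0 (R : pzRingType) : noeth 'rV[R]_0.
Proof.
by move=> N; exists [::] => // x _ S _; rewrite [x]thinmx0 rpred0.
Qed.

Lemma noeth_inj (R : pzRingType) (M A : lmodType R) (f : {linear M -> A}) :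
  injective f -> noeth A -> noeth M.
Proof.
move=> fI; apply: (@noeth_ext _ 'rV[R]_0 _ _ \0 f) => [x fx|].
  by exists 0; apply: fI; rewrite fx /= linear0.
exact: noeth_row0.
Qed.

Lemma noeth_surj (R : pzRingType) (M B : lmodType R) (g : {linear B -> M}) :
  (forall x, exists b, g b = x) -> noeth B -> noeth M.
Proof.
move=> gS noethB.
by apply: (@noeth_ext _ _ _ 'rV[R]_0 g \0) => //; exact: noeth_row0.
Qed.

Lemma noeth_row (R : pzRingType) n : noeth R^o -> noeth 'rV[R]_n.
Proof.
move=> noethR; elim: n => [|n IHn]; first exact: noeth_row0.
have gL : linear (fun v : 'rV[R]_n => row_mx (0 : 'rV[R]_1) v : 'rV[R]_(1 + n)).
  by move=> a v w; rewrite scale_row_mx add_row_mx scaler0 addr0.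
have fL : linear (fun v : 'rV[R]_(1 + n) => v 0 0 : R^o).
  by move=> a v w; rewrite !mxE.
apply: (@noeth_ext _ _ _ _ (linear_of gL) (linear_of fL)) => //= v v0.
exists (rsubmx v); rewrite -[RHS]hsubmxK; congr row_mx.
apply/rowP => i; rewrite !mxE ord1 -[LHS]v0; congr (v 0 _); exact/val_inj.
Qed.

Lemma noeth_finitely_generated (R : pzRingType) (M : lmodType R) :
  noeth M -> forall N : submodClosed M, finitely_generated (submod N).
Proof.
move=> noethM N; have [n [e [eN Ne]]] := fg_submodP (noethM N).
exists n, (fun i => Submod (eN i)) => x.
have [c xE] := Ne _ (valP x).
exists c; apply: val_inj; rewrite xE -[RHS]/(submod_incl N _) linear_sum; apply: eq_bigr => i _.
by rewrite /submod_incl linearZ.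
Qed.

Lemma corestriction (R : pzRingType) (A M : lmodType R) (N : submodClosed M)
    (f : {linear A -> M}) : (forall a, f a \in N) ->
  exists g : {linear A -> submod N}, forall a, submod_incl N (g a) = f a.
Proof.
move=> fN; have gL : linear (fun a => Submod (fN a)).
  move=> r a b; apply: val_inj; rewrite -[RHS]/(submod_incl N _).
  by rewrite [RHS]linearP -[LHS]/(f _) linearP.
by exists (linear_of gL).
Qed.

Lemma row_comb_linear (R : pzRingType) (M : lmodType R) n (e : 'I_n -> M) :
  linear (fun v : 'rV[R]_n => \sum_k v 0 k *: e k).
Proof.
move=> a v w; rewrite scaler_sumr -big_split; apply: eq_bigr => k _.
by rewrite !mxE scalerDl scalerA.
Qed.

Lemma row_combE (R : pzRingType) (M : lmodType R) n (e : 'I_n -> M) c :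
  \sum_i c i *: e i = linear_of (row_comb_linear e) (\row_i c i).
Proof. by apply: eq_bigr => i _; rewrite mxE. Qed.

(** The kernel of R^n -> M is a submodule of the Noetherian module R^n, so it has finitely many
    generators; they define c. *)
Lemma finite_presentation (R : pzRingType) (M : lmodType R) :
  noeth R^o -> finitely_generated M ->
  exists (n q : nat) (p : {linear 'rV[R]_n -> M})
    (c : {linear 'rV[R]_q -> 'rV[R]_n}),
    (forall x, exists v, p v = x) /\ exact_at c p.
Proof.
move=> noethR [n [e eM]]; pose p := linear_of (row_comb_linear e).
have [||K KE] := @submod_of_prop _ _ (fun v => p v = 0); first exact: linear0.
  by move=> a x y px py; rewrite linearP px py scaler0 addr0.
have [q [d [dK Kd]]] := fg_submodP (noeth_row noethR K).
exists n, q, p, (linear_of (row_comb_linear d)); split.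
  by move=> x; have [c ->] := eM x; rewrite row_combE; eexists.
move=> v; split=> [/KE/Kd[c ->]|[w <-]]; first by rewrite row_combE; eexists.
by apply/KE; rewrite rpred_sum // => i _; rewrite rpredZ.
Qed.

(** Values at the generators of M embed M^* in a free right module of finite rank, which is
    Noetherian. *)
Lemma dual_finitely_generated (R : pzRingType) (M : lmodType R) :
  noeth R^c^o -> finitely_generated M -> finitely_generated (dual M).
Proof.
move=> noethR [n [e eM]]; pose p := linear_of (row_comb_linear e).
have pS x : exists v, p v = x.
  by have [c ->] := eM x; rewrite row_combE; eexists.
have [||T TE] := @submod_of_prop _ (dual M) (fun=> True) => //.
have [m [g [_ gT]]] :=
  fg_submodP (noeth_inj (dual_coord_inj pS) (noeth_row noethR) T).
by exists m, g => x; apply/gT/TE.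
Qed.

(** * Maps from the bidual to an injective module *)

Section RdualEval.
Variables (R : pzRingType) (N : lmodType R^c) (g : N).
Definition rdual_eval_fun (phi : rdual N) : R^o := phi g.
Lemma rdual_eval_linear : linear rdual_eval_fun.
Proof. by []. Qed.
Definition rdual_eval := linear_of rdual_eval_linear.
End RdualEval.

(* Generators of M^* embed M^** in a free module R^m, so by injectivity f comes *)
(* from some t in E^m; the tensor of M^* (x) E attached to t is killed by all   *)
(* evaluations at points of M.                                                  *)
Lemma bidual_hom_eq0 (R : pzRingType) (M E : lmodType R)
    (f : {linear rdual (dual M) -> E}) :
  finitely_generated (dual M) -> injective_module E ->
  (forall t : tensor (dual M) E, (forall y, dual_eval E y t = 0) -> t = 0) ->
  (forall y, f (sigma y) = 0) -> forall phi, f phi = 0.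
Proof.
move=> [m [g gM]] injE tensE fs phi.
have kL : linear (fun phi : rdual (dual M) => \row_j (phi (g j) : R)).
  by move=> a x y; apply/rowP => j; rewrite !mxE.
have kI : injective (linear_of kL).
  move=> x y /rowP xy; apply: homP => h; have [c ->] := gM h.
  rewrite !linear_sum; apply: eq_bigr => j _; rewrite !linearZ /=.
  by have := xy j; rewrite !mxE => ->.
have [f' f'E] := injE _ _ _ f kI.
have fE x : f x = \sum_j (x (g j) : R) *: f' 'e_j.
  rewrite -f'E [linear_of kL x]row_sum_delta linear_sum.
  by apply: eq_bigr => j _; rewrite linearZ mxE.
(* Pairing with phi sends the tensor of the g_j (x) f'(e_j) to f phi, while its evaluation at y is f
   (sigma y) = 0. *)
have [||| h hE] := @tensor_lift R (dual M) E E (fun g x => (phi g : R) *: x).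
- by move=> x y z; rewrite linearD scalerDl.
- by move=> x y z; rewrite scalerDr.
- by move=> r x y; rewrite linearZ scalerA.
transitivity (h (\sum_j tens (g j) (f' 'e_j))).
  by rewrite fE raddf_sum; apply: eq_bigr => j _; rewrite hE.
rewrite (tensE (\sum_j _)) ?raddf0 // => y.
by rewrite raddf_sum -[RHS](fs y) fE; apply: eq_bigr => j _; rewrite /= dual_eval_tens.
Qed.

(** * Reflexivity of I and pseudo-null submodules of R/I *)

Section Reflexive.
Variables (R : pzRingType) (E : min_inj_resolution R^o) (I : submodClosed R^o).

Local Notation incl := (submod_incl I : dual (submod I)).

(** The inclusion of I in R is a functional that already separates the points of I. *)
Lemma sigma_ideal_inj : injective (@sigma R (submod I)).
Proof.
move=> x y xy; apply: val_inj.
exact: (congr1 (fun phi : rdual (dual (submod I)) => phi incl) xy).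
Qed.

(** The cokernel of sigma has no non-zero map to E_0 or E_1; this is what the 2-Gorenstein condition
    contributes. *)
Hypothesis bidual_hom0 : forall n (f : {linear rdual (dual (submod I)) -> E n}),
  (n < 2)%N -> (forall y, f (sigma y) = 0) -> forall phi, f phi = 0.

(* The kernel K of phi |-> phi incl meets I trivially, so a map K -> E 0 extends *)
(* by 0 on I to M^**, hence is 0.                                                *)
Lemma bidual_eval_incl_eq0 (phi : rdual (dual (submod I))) : phi incl = 0 -> phi = 0.
Proof.
move=> phi0; have [||K KE] := @submod_of_prop _ _ (fun phi => rdual_eval incl phi = 0).
- exact: linear0.
- by move=> a x y xE yE; rewrite linearP xE yE scaler0 addr0.
(* As R embeds in E_0, it suffices to kill the map k |-> k(g) from K to E_0, evaluated at phi. *)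
apply: homP => g; apply: (@res_aug_inj _ _ E); rewrite [RHS]linear0.
have iL : linear (fun ky : (submod K * submod I)%type =>
    submod_incl K ky.1 + sigma ky.2).
  by move=> a x y; rewrite /= !linearP scalerDr addrACA.
have fL : linear (fun ky : (submod K * submod I)%type =>
    res_aug E (rdual_eval g (submod_incl K ky.1))).
  by move=> a x y; rewrite /= !linearP.
have iI : injective (linear_of iL).
  move=> [k y] [k' y'] /= kk'.
  have Kincl (k0 : submod K) : (submod_incl K k0 : rdual _) incl = 0.
    exact/KE/valP.
  have yy' : y = y'.
    apply: val_inj.
    have := congr1 (rdual_eval incl) kk'; rewrite !linearD /=.
    by rewrite /rdual_eval_fun !Kincl !add0r.
  by move: kk'; rewrite yy' => /addIr/val_inj ->.
have [h hE] := res_injective (linear_of fL) iI.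
have phiK : phi \in K by apply/KE.
have := hE (Submod phiK, 0); rewrite /= linear0 addr0 => <-.
apply: (bidual_hom0 (n := 0)) => // y.
have -> : sigma y = linear_of iL (0, y).
  by rewrite -[RHS]/(submod_incl K 0 + sigma y) linear0 add0r.
by rewrite hE -[LHS]/(res_aug E (rdual_eval g (submod_incl K 0))) !linear0.
Qed.

Lemma reflexive_of_torsionfree_quotient : noeth R^o ->
  (forall N : submodClosed (quotmod I),
     pseudo_null E (submod N) -> forall q, q \in N -> q = 0) ->
  reflexive_module (submod I).
Proof.
move=> noethR noPN; split; first exact: noeth_finitely_generated.
(* The image N of f in R/I is a quotient of I^** on which sigma(I) becomes 0, so N is
   pseudo-null. *)
pose f : {linear _ -> _} := quotmod_pi I \o rdual_eval incl.
have [||N NE] := @submod_of_prop _ _ (fun q => exists phi, f phi = q).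
- by exists 0; rewrite linear0.
- by move=> a _ _ [x <-] [y <-]; exists (a *: x + y); rewrite linearP.
have [|f' f'E] := @corestriction _ _ _ N f; first by move=> a; apply/NE; exists a.
have f'S x : exists phi, f' phi = x.
  have /NE[phi phiE] := valP x; exists phi.
  by apply: val_inj; rewrite -[LHS]/(submod_incl N _) f'E.
have f's y : f' (sigma y) = 0.
  apply: val_inj; rewrite -[LHS]/(submod_incl N _) f'E.
  exact/quotmod_pi0/valP.
have N0 : pseudo_null E (submod N).
  split.
    apply: noeth_finitely_generated.
    apply: (noeth_surj (g := quotmod_pi I)) noethR.
    by elim/quotmodW => x; exists x.
  move=> h x; have [phi <-] := f'S x.
  have h0 y : h (f' (sigma y)) = 0 by rewrite f's linear0.
  rewrite [LHS]surjective_pairing /=; congr (_, _).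
    by apply: (bidual_hom0 (n := 0) (f := fst \o h \o f')) => // y; rewrite /= h0.
  by apply: (bidual_hom0 (n := 1) (f := snd \o h \o f')) => // y; rewrite /= h0.
(* Since N = 0, [phi incl] is an element of I; its image under sigma agrees with phi at the
   inclusion, hence everywhere. *)
have sigmaS (phi : rdual (dual (submod I))) : exists y, sigma y = phi.
  have phiI : (phi incl : R^o) \in I.
    by apply/quotmod_pi0/(noPN N N0)/NE; exists phi.
  exists (Submod phiI); apply/eqP; rewrite -subr_eq0; apply/eqP.
  apply: bidual_eval_incl_eq0.
  by apply/eqP; rewrite subr_eq0.
have [s sK] := choice sigmaS.
by exists s => [x|//]; apply: sigma_ideal_inj; rewrite sK.
Qed.

Lemma torsionfree_quotient_of_reflexive : reflexive_module (submod I) ->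
  forall N : submodClosed (quotmod I),
    pseudo_null E (submod N) -> forall q, q \in N -> q = 0.
Proof.
move=> [_ [s _ sK]] N [_ N0].
have [||J JE] := @submod_of_prop _ _ (fun x => quotmod_pi I x \in N).
- by rewrite linear0 rpred0.
- by move=> a x y xN yN; rewrite linearP rpredD ?rpredZ.
have IJ x : x \in I -> x \in J by move=> /quotmod_pi0 xI; apply/JE; rewrite xI rpred0.
have [|i iE] := @corestriction _ _ _ J (submod_incl I).
  by move=> x; apply/IJ/valP.
have iI : injective i.
  by move=> x y xy; apply: val_inj; rewrite -[LHS]iE xy iE.
have [|p pE] := @corestriction _ _ _ N (quotmod_pi I \o submod_incl J).
  by move=> x; apply/JE/valP.
have pS x : exists y, p y = x.
  case: x => q qN; elim/quotmodW: q qN => x xN; have xJ : x \in J by apply/JE.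
  by exists (Submod xJ); apply: val_inj; rewrite -[LHS]/(submod_incl N _) pE.
have pker x : p x = 0 -> exists y, i y = x.
  move=> px; have xI : submod_incl J x \in I.
    by apply/quotmod_pi0; rewrite -[LHS]pE px linear0.
  by exists (Submod xI); apply: val_inj; rewrite -[LHS]/(submod_incl J _) iE.
have comb0 (V : lmodType R) a : 0 = a *: 0 + 0 :> V by rewrite scaler0 addr0.
(* Such a map factors through N = J/I, which has no non-zero map to E_0 or E_1. *)
have van n (h : {linear submod J -> E n}) : (n < 2)%N ->
    (forall y, h (i y) = 0) -> forall x, h x = 0.
  move=> n2 hi x.
  have [h' h'E] : exists h' : {linear submod N -> E n}, forall a, h' (p a) = h a.
    by apply: factor_surj => // a /pker[y <-].
  rewrite -h'E; case: n n2 h h' {hi h'E} => [|[|//]] _ h h'.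
    have hL : linear (fun x => (h' x, 0) : (E 0 * E 1)%type).
      by move=> a u v; rewrite linearP [in LHS](comb0 (E 1) a).
    by have := N0 (linear_of hL) (p x) => -[].
  have hL : linear (fun x => (0, h' x) : (E 0 * E 1)%type).
    by move=> a u v; rewrite linearP [in LHS](comb0 (E 0) a).
  by have := N0 (linear_of hL) (p x) => -[].
(* Composed with R -> E_0, the difference of two extensions vanishes on I, so the case n = 0
   applies. *)
have uniq_ext (g g' : dual (submod J)) : (forall y, g (i y) = g' (i y)) -> g = g'.
  move=> gg'; apply: homP => x; apply/eqP; rewrite -subr_eq0; apply/eqP.
  apply: (@res_aug_inj _ _ E); rewrite [RHS]linear0.
  apply: (van 0 (res_aug E \o (g - g'))) => // y.
  by rewrite /= gg' subrr linear0.
(* Injectivity of E_0 extends g to h : J -> E_0. The composite of h with E_0 -> E_1 kills I, so it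
   is 0 by the case n = 1, and exactness puts the values of h in R. *)
have /choice[ext extE] (g : dual (submod I)) :
    exists g' : dual (submod J), forall y, g' (i y) = g y.
  have [h hE] := res_injective (res_aug E \o g) iI.
  have hx x : exists r, res_aug E r = h x.
    apply/res_exact0; apply: (van 1 (res_diff E 0 \o h)) => // y.
    by rewrite /= hE; apply/res_exact0; eexists.
  have [g' g'E] := choice hx.
  have g'L : linear g'.
    by move=> a x y; apply: (@res_aug_inj _ _ E); rewrite linearP !g'E linearP.
  exists (linear_of g'L) => y; apply: (@res_aug_inj _ _ E).
  by rewrite g'E hE.
elim/quotmodW => x xN; have xJ : x \in J by apply/JE.
(* Evaluation of extensions at x is linear in g because extensions are unique; it is the element of
   I^** attached to x. *)
have phiL : linear (fun g => ext g (Submod xJ) : R^c^o).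
  move=> r g g'; have -> : ext (r *: g + g') = r *: ext g + ext g'; last by [].
  apply: uniq_ext => y.
  by rewrite -[RHS]/((ext g (i y) : R) * (r : R) + ext g' (i y)) !extE.
pose phi : rdual (dual (submod I)) := linear_of phiL.
apply/quotmod_pi0.
have extincl : ext incl = submod_incl J.
  by apply: uniq_ext => y; rewrite extE [RHS]iE.
(* By reflexivity phi is evaluation at [s phi] in I. At the inclusion of I, whose extension is the
   inclusion of J, this gives x = [s phi]. *)
have <- : submod_incl I (s phi) = x.
  by rewrite -[LHS]/(sigma (s phi) incl) sK -[LHS]/(ext incl (Submod xJ)) extincl.
exact: valP.
Qed.
End Reflexive.

Theorem corollary4p4 (Lambda : pzRingType)
    (lnoeth : left_noetherian Lambda) (rnoeth : right_noetherian Lambda)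
    (E : min_inj_resolution Lambda^o) (gor : two_gorenstein E)
    (I : submodClosed Lambda^o)
    (nonzero : exists2 x, x \in I & x != 0) (proper : exists x, x \notin I) :
  reflexive_module (submod I) <->
  (forall N : submodClosed (quotmod I),
     pseudo_null E (submod N) -> forall q, q \in N -> q = 0).
Proof.
split; first exact: torsionfree_quotient_of_reflexive.
have noethL : noeth Lambda^o := noetherian_fg lnoeth.
have noethR : noeth Lambda^c^o := noetherian_fg rnoeth.
have fgI := noeth_finitely_generated noethL I.
have [n [q [p [c [pS cp]]]]] := finite_presentation noethL fgI.
apply: reflexive_of_torsionfree_quotient => // k f k2.
apply: bidual_hom_eq0; first exact: dual_finitely_generated.
  exact: res_injective.
(* E_0 falls under the flat case, E_1 under flat dimension at most 1. *)
case: k k2 f => [|[|//]] _ _ t; have [flat0 fd1] := gor.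
  exact: dual_tensor_flat pS _ _ flat0.
exact: dual_tensor_fd1 pS _ _ cp _ _ fd1.
Qed.
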